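(* Let $\mu$ be a probability measure on $[-1,1]$ with finite support $t_k<t_{k-1}<\cdots<t_1$, and put $p_i=\mu(\{t_i\})$, $i=1,\ldots,k$, so that $p_i>0$ and $p_1+\cdots+p_k=1$. Let $\varepsilon>0$ and let $f:(-\varepsilon,\varepsilon)\to\mathbb{R}$ be a continuous function such that $0$ is an isolated local minimum of $f$, $f$ is strictly decreasing on $(-\varepsilon,0]$ and strictly increasing on $[0,\varepsilon)$, $f$ is of class $C^1$ on $(-\varepsilon,0)\cup(0,\varepsilon)$, and there exist finite or infinite limits $$L=\lim_{x\to0-0}f'(x),\qquad R=\lim_{x\to0+0}f'(x).$$ If $L$ and $R$ are finite, put, for $j=1,\ldots,k-1$, $$X_j=L(p_1+\cdots+p_j)+R(p_{j+1}+\cdots+p_k).$$ Suppose that one of the following conditions holds: (a) both limits $L$ and $R$ are finite and $X_j\neq0$ for $j=1,\ldots,k-1$; (b) one of the limits $L$, $R$ is infinite and the other one is finite. Then the germ of $f$ at $0$ is topologically stable with respect to averagings by the measure $\mu$.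
   Context: Averaging. For a function $f$ defined on an interval $(a,b)$ and $\alpha>0$ with $2\alpha<b-a$, the $\alpha$-averaging of $f$ with respect to a probability (Borel) measure $\mu$ on $[-1,1]$ is the function on $(a+\alpha,b-\alpha)$ given by $f_\alpha(x)=\int_{-1}^{1}f(x-t\alpha)\,d\mu(t)$; for $\mu$ with finite support $\{t_1,\ldots,t_k\}$ this is $f_\alpha(x)=\sum_{i=1}^k f(x-t_i\alpha)\,p_i$ with $p_i=\mu(\{t_i\})$. Topological equivalence. Continuous functions $f:(a,b)\to\mathbb{R}$ and $g:(c,d)\to\mathbb{R}$ are topologically equivalent if there exist orientation preserving (i.e. strictly increasing) homeomorphisms $h:(a,b)\to(c,d)$ and $\phi:\mathbb{R}\to\mathbb{R}$ such that $\phi\circ f=g\circ h$. Local stability. The germ at $a\in\mathbb{R}$ of a continuous function $f$ defined near $a$ is its class under the relation of coinciding on some neighborhood of $a$. The germ $f:(\mathbb{R},a)\to\mathbb{R}$ is topologically stable with respect to averagings by $\mu$ if there exists $\varepsilon'>0$ (small enough that $f$ and, for $\alpha\in(0,\varepsilon')$, $f_\alpha$ are defined on $(a-\varepsilon',a+\varepsilon')$) such that for each $\alpha\in(0,\varepsilon')$ there exist $c_1,c_2,d_1,d_2\in(a-\varepsilon',a+\varepsilon')$, depending on $\alpha$, with $c_1<a<c_2$, $d_1<d_2$, and such that the restrictions $f|_{(c_1,c_2)}$ and $f_\alpha|_{(d_1,d_2)}$ are topologically equivalent. *)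

(* Defs.v *)
From HB Require Import structures.
From mathcomp Require Import all_boot all_order all_algebra.
From mathcomp Require Import all_classical all_reals all_analysis.

Set Implicit Arguments.
Unset Strict Implicit.
Unset Printing Implicit Defensive.

Import Order.TTheory GRing.Theory Num.Theory.
Import numFieldNormedType.Exports.

Local Open Scope classical_set_scope.
Local Open Scope ring_scope.

(* A function on an interval (a, b) is a total function K -> K of which only
   the values on `]a, b[ are relevant.  A probability measure on [-1, 1] is a
   Borel probability on the line giving mass 1 to `[-1, 1]. *)

Definition measure_support (K : realType)
    (mu : probability (measurableTypeR K) K) : set K :=
  [set t | forall U : set K, open U -> U t -> (0 < mu U)%E].

(* If f is defined on (a, b), this is meaningful for x in
   (a + alpha, b - alpha). *)
Definition averaging (K : realType) (mu : probability (measurableTypeR K) K)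
    (alpha : K) (f : K -> K) (x : K) : K :=
  \int[mu]_(t in `[-1, 1]) f (x - t * alpha).

Definition increasing_homeo (K : realType) (A B : set K) (h : K -> K) : Prop :=
  {in A &, {homo h : x y / x < y}} /\
  exists g : K -> K,
    [/\ set_fun A B h, set_fun B A g,
        {in A, cancel h g} /\ {in B, cancel g h},
        {within A, continuous h} & {within B, continuous g}].

Definition top_equivalent (K : realType) (a b c d : K) (f g : K -> K) : Prop :=
  exists h phi : K -> K,
    [/\ increasing_homeo `]a, b[ `]c, d[ h,
        increasing_homeo setT setT phi
      & {in `]a, b[, forall x, phi (f x) = g (h x)}].

(* f is defined on (u, v).  The inequalities involving u and v express that f
   and f_alpha are defined on (a - e, a + e). *)
Definition stable_representative (K : realType)
    (mu : probability (measurableTypeR K) K) (a u v : K) (f : K -> K) : Prop :=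
  exists e : K,
    [/\ 0 < e, u <= a - e /\ a + e <= v
      & forall alpha : K, 0 < alpha < e ->
          (u + alpha <= a - e /\ a + e <= v - alpha) /\
          exists c1 c2 d1 d2 : K,
            [/\ [/\ c1 \in `]a - e, a + e[, c2 \in `]a - e, a + e[,
                    d1 \in `]a - e, a + e[ & d2 \in `]a - e, a + e[],
                c1 < a < c2, d1 < d2
              & top_equivalent c1 c2 d1 d2 f (averaging mu alpha f)]].

(* The germ of f at a is the class of all continuous functions, each defined
   on some interval around a, that coincide with f near a; stability is
   required of every representative, so that it depends on the germ only. *)
Definition germ_stable (K : realType)
    (mu : probability (measurableTypeR K) K) (a : K) (f : K -> K) : Prop :=
  forall (u v : K) (g : K -> K),
    u < a < v -> {in `]u, v[, continuous g} ->
    (\forall x \near a, g x = f x) ->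
    stable_representative mu a u v g.

Definition local_min (K : realType) (f : K -> K) (a : K) : Prop :=
  \forall x \near a, f a <= f x.

Definition isolated_local_min (K : realType) (f : K -> K) (a : K) : Prop :=
  local_min f a /\ \forall x \near a^', ~ local_min f x.

(* With p 0, p 1, ... standing for p_1, p_2, ..., the weights p_1, ..., p_j
   are those of index i < j. *)
Definition Xsum (K : realType) (k : nat) (p : 'I_k -> K) (l r : K)
    (j : nat) : K :=
  l * (\sum_(i < k | (i < j)%N) p i) + r * (\sum_(i < k | (j <= i)%N) p i).

(* Main.v *)
Require Import Defs.
From mathcomp Require Import all_boot all_order all_algebra.
From mathcomp Require Import all_classical all_reals all_analysis.
From mathcomp Require Import measurable_realfun.
From mathcomp Require Import lra.

Set Implicit Arguments.
Unset Strict Implicit.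
Unset Printing Implicit Defensive.

Import Order.TTheory GRing.Theory Num.Theory.
Import numFieldNormedType.Exports.

Local Open Scope classical_set_scope.
Local Open Scope ring_scope.

(** For a measure with finite support, the averaging of f is the weighted
sum of the translates x |-> f (x - t_i alpha).  Since a point x lies to the
right of the corners t_i alpha of some translates and to the left of the
others, the corners cut a neighbourhood of 0 into finitely many pieces.  On
the piece between t_(j+1) alpha and t_j alpha the translates 1, ..., j are on
their decreasing branch and the others on their increasing branch, so by the
mean value theorem the increments of the averaging are (sum p_i q_i) (y - x)
with slopes q_i close to L for i <= j and close to R for i > j
([weighted_average_slopes]).  For small alpha the sign of this sum is that of
X_j when L and R are finite, and it is dictated by the infinite limit
otherwise, because an arbitrarily steep slope of positive weight outweighs
the bounded ones.  As f decreases and then increases, L <= 0 <= R, hence X_j is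
nonincreasing in j: going from left to right the averaging decreases on the
first pieces and increases on the remaining ones
([slopes_sign_change_exists]).  Left of all corners it decreases and right of
all corners it increases, merely because every translate does.  So near 0 the
averaging has the same shape as f: it is strictly decreasing up to one corner
and strictly increasing after it ([weighted_average_valley]).

Any two continuous functions of this shape are topologically equivalent near
their minima ([valley_top_equivalent]): up to a translation of the values,
each is the absolute value read in a suitable increasing chart
([valley_chart]), and composing one chart with the inverse of the other gives
the homeomorphism of the sources. *)

(** * Probability measures with finite support *)

(** A point outside the support has a null neighbourhood, which contains an
interval with rational endpoints around the point; only countably many such
intervals exist. *)
Lemma measure_support_setC_null (K : realType)
    (mu : probability (measurableTypeR K) K) :
  mu.-negligible (~` measure_support mu).
Proof.
pose J (q : rat * rat) : set K := `]ratr q.1, ratr q.2[%classic.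
pose N (n : nat) : set K :=
  if unpickle n is Some q then (if mu (J q) == 0 then J q else set0) else set0.
have : mu.-negligible (\bigcup_n N n).
  apply: negligible_bigcup => n; rewrite /N.
  case: unpickle => [q|]; last exact: negligible_set0.
  case: ifPn => [/eqP q0|_]; last exact: negligible_set0.
  exists (J q); split => //; exact: measurable_itv.
apply: negligibleS => x /existsNP[U /not_implyP[oU /not_implyP[Ux]]].
move=> /negP; rewrite -leNgt => muU.
have /nbhs_ballP[e /= e0 xeU] : nbhs x U by exact: open_nbhs_nbhs.
have [q1 q1x] : exists q : rat, ratr q \in `](x - e), x[.
  by apply: rat_in_itvoo; rewrite ltrBlDr ltrDl.
have [q2 q2x] : exists q : rat, ratr q \in `]x, (x + e)[.
  by apply: rat_in_itvoo; rewrite ltrDl.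
(* The code of the pair is kept abstract: unfolding it would compute with
   encodings of rationals. *)
have [n nE] : exists n : nat, unpickle n = Some (q1, q2).
  by exists (pickle (q1, q2)); exact: pickleK.
exists n; [exact: I|rewrite /N nE].
have JU : J (q1, q2) `<=` U.
  move=> y; rewrite /J /= in_itv/= => yJ; apply: xeU.
  by rewrite /ball/= ltr_norml; move: q1x q2x; rewrite !in_itv/=; lra.
have -> : mu (J (q1, q2)) == 0.
  rewrite eq_le measure_ge0 andbT (le_trans _ muU)//.
  by rewrite le_measure// inE; [exact: measurable_itv|exact: open_measurable].
by move: q1x q2x; rewrite /J /= !in_itv/=; lra.
Qed.

(** Off the support the integrand is integrated over a null set, and on each
atom it is constant. *)
Lemma Rintegral_finite_support (K : realType)
    (mu : probability (measurableTypeR K) K) (k : nat) (t : 'I_k -> K)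
    (p : 'I_k -> K) (D : set K) (g : K -> K) :
  injective t -> measure_support mu = range t ->
  (forall i : 'I_k, mu [set t i] = (p i)%:E) ->
  measurable D -> (forall i, D (t i)) -> measurable_fun D g ->
  \int[mu]_(x in D) g x = \sum_(i < k) p i * g (t i).
Proof.
move=> t_inj supp mup mD Dt mg.
have DE : range t = \big[setU/set0]_(i <- index_enum 'I_k) [set t i].
  apply/seteqP; split=> [_ [i _ <-]|x].
    by rewrite (bigD1 i)//=; left.
  by rewrite -bigcup_seq => -[i _ ->]; exists i.
have mt : measurable (range t : set (measurableTypeR K)).
  by rewrite DE; apply: bigsetU_measurable.
have tD : range t `<=` D by move=> _ [i _ <-].
have null : mu (D `\` range t) = 0.
  have [N [mN N0 sN]] := measure_support_setC_null mu.
  apply/eqP; rewrite eq_le measure_ge0 andbT -N0 le_measure// ?inE//.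
    exact: measurableD.
  by move=> x [_]; rewrite -supp => /sN.
have mgt : measurable_fun (\big[setU/set0]_(i <- index_enum 'I_k) [set t i]) (EFin \o g).
  by rewrite -DE; apply/measurable_EFinP; apply: measurable_funS mg.
have mgD : measurable_fun D (EFin \o g) by exact/measurable_EFinP.
rewrite /Rintegral -(setDKU tD) integral_setU//; last 3 first.
- exact: measurableD.
- by rewrite setDKU.
- by rewrite disj_set2E setIC setDIK.
rewrite null_set_integral ?add0e//; last 2 first.
- exact: measurableD.
- by apply: measurable_funS mgD => // x [].
rewrite DE integral_bigsetU_EFin//; last 2 first.
- exact: index_enum_uniq.
- by move=> i j _ _ [x [/= -> /t_inj]].
rewrite (eq_bigr (fun i => (p i * g (t i))%:E)); first by rewrite sumEFin.
move=> i _; rewrite (eq_integral (cst (g (t i))%:E)).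
  by rewrite integral_cst// EFinM muleC; congr (_ * _)%E; exact: mup.
by move=> x; rewrite inE => /= ->.
Qed.

Lemma measure_support_closed (K : realType)
    (mu : probability (measurableTypeR K) K) (C : set K) :
  closed C -> mu C = 1%E -> measure_support mu `<=` C.
Proof.
move=> cC muC x xs; apply: contrapT => nCx.
have := xs (~` C) (closed_openC cC) nCx.
have mC : measurable (C : set (measurableTypeR K)) by exact: closed_measurable.
by rewrite -[mu _]/(mu (~` C)) probability_setC// muC subee// ltxx.
Qed.

(** Removing the other atoms from the line leaves an open neighbourhood of
[t i]; it has positive measure, all of it carried by [t i]. *)
Lemma finite_support_weight_gt0 (K : realType)
    (mu : probability (measurableTypeR K) K) (k : nat) (t : 'I_k -> K)
    (p : 'I_k -> K) (i : 'I_k) :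
  injective t -> measure_support mu = range t ->
  (forall i : 'I_k, mu [set t i] = (p i)%:E) -> 0 < p i.
Proof.
move=> t_inj supp mup; rewrite -lte_fin -mup.
pose U : set K := ~` (t @` [set j | j != i]).
have fU : finite_set (t @` [set j | j != i]) by apply: finite_image; exact: (@finite_finpred _ _ [pred j | j != i]).
have oU : open U.
  apply: closed_openC; apply: (compact_closed (@Rhausdorff K)).
  exact: finite_compact fU.
have tiU : U (t i) by move=> [j /= ji /t_inj]; apply/eqP.
have ti : measure_support mu (t i) by rewrite supp; exists i.
apply: (lt_le_trans (ti U oU tiU)).
have [N [mN N0 sN]] := measure_support_setC_null mu.
have UN : U `<=` [set t i] `|` N.
  move=> x Ux; have [xs|xs] := pselect (measure_support mu x); last first.
    by right; exact: sN.
  left; move: xs; rewrite supp => -[j _ jx] /=; have [->//|ji] := eqVneq i j.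
  by case: Ux; exists j => //=; rewrite eq_sym.
have mU : measurable (U : set (measurableTypeR K)) by exact: open_measurable.
apply: (le_trans (le_measure mu _ _ UN)); rewrite ?inE//.
  exact: measurableU.
have N0' : (mu N <= 0)%E by rewrite N0.
apply: (le_trans (measureU2 _ _ _)) => //.
by rewrite -[leRHS]adde0; exact: leeD.
Qed.

Lemma finite_support_weight_sum (K : realType)
    (mu : probability (measurableTypeR K) K) (k : nat) (t : 'I_k -> K)
    (p : 'I_k -> K) :
  injective t -> measure_support mu = range t ->
  (forall i : 'I_k, mu [set t i] = (p i)%:E) -> \sum_(i < k) p i = 1.
Proof.
move=> t_inj supp mup.
have <- := eq_bigr _ (fun i (_ : xpredT i) => mulr1 (p i)).
rewrite -(Rintegral_finite_support (D := setT) (g := cst 1) t_inj supp mup)//.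
by rewrite Rintegral_cst// mul1r [X in fine X]probability_setT.
Qed.

Lemma averaging_finite_support (K : realType)
    (mu : probability (measurableTypeR K) K) (k : nat) (t : 'I_k -> K)
    (p : 'I_k -> K) (g : K -> K) (u v alpha x : K) :
  injective t -> measure_support mu = range t ->
  (forall i : 'I_k, mu [set t i] = (p i)%:E) ->
  (forall i, -1 <= t i <= 1) ->
  {in `]u, v[, continuous g} ->
  (forall s : K, -1 <= s <= 1 -> u < x - s * alpha < v) ->
  averaging mu alpha g x = \sum_(i < k) p i * g (x - t i * alpha).
Proof.
move=> t_inj supp mup t1 g_cont xuv.
rewrite /averaging.
have tI i : `[-1, 1]%classic (t i) by rewrite /= in_itv/=; exact: t1.
apply: (Rintegral_finite_support t_inj supp mup _ tI) => //.
apply: subspace_continuous_measurable_fun => //.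
apply: continuous_in_subspaceT => s; rewrite inE/= in_itv/= => s1.
suff : {for (s : K), continuous (g \o (fun w : K => x - w * alpha))} by [].
apply: continuous_comp.
  by apply: cvgB; [exact: cvg_cst|apply: cvgM; [exact: cvg_id|exact: cvg_cst]].
by apply: g_cont; rewrite in_itv/=; exact: xuv.
Qed.

(** * Valleys and their topological equivalence *)

Definition valley (K : realType) (F : K -> K) (u s v : K) : Prop :=
  [/\ u < s < v, {in `]u, v[, continuous F},
      forall x y : K, u < x -> x < y -> y <= s -> F y < F x
    & forall x y : K, s <= x -> x < y -> y < v -> F x < F y].

Lemma increasing_homeo_in (K : realType) (A B : set K) (h : K -> K) (x : K) :
  increasing_homeo A B h -> x \in A -> h x \in B.
Proof. by move=> [_ [g [hAB _ _ _ _]]] /set_mem/hAB/mem_set. Qed.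

Lemma increasing_homeo_inverse (K : realType) (A B : set K) (h : K -> K) :
  increasing_homeo A B h ->
  exists2 g : K -> K, increasing_homeo B A g & {in B, cancel g h}.
Proof.
move=> [h_lt [g [hAB gBA [hK gK] hc gc]]]; exists g => //.
split; last by exists h.
move=> x y xB yB xy; rewrite ltNge le_eqVlt; apply/negP => /orP[/eqP gyx|gyx].
  by move: xy; rewrite -(gK x)// -(gK y)// gyx ltxx.
move/set_mem : (xB) => /gBA/mem_set gxA; move/set_mem : (yB) => /gBA/mem_set gyA.
have := h_lt _ _ gyA gxA gyx.
by rewrite !gK// => /(lt_trans xy); rewrite ltxx.
Qed.

Lemma increasing_homeo_comp (K : realType) (A B C : set K) (h1 h2 : K -> K) :
  open A -> open B -> open C ->
  increasing_homeo A B h1 -> increasing_homeo B C h2 ->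
  increasing_homeo A C (h2 \o h1).
Proof.
move=> oA oB oC [lt1 [g1 [hAB gBA [hK1 gK1] hc1 gc1]]].
move=> [lt2 [g2 [hBC gCB [hK2 gK2] hc2 gc2]]].
have inB x : x \in A -> h1 x \in B by move=> /set_mem/hAB/mem_set.
have inB' x : x \in C -> g2 x \in B by move=> /set_mem/gCB/mem_set.
split; first by move=> x y xA yA xy; apply: lt2; [exact: inB..|exact: lt1].
exists (g1 \o g2); split.
- by move=> x /hAB/hBC.
- by move=> x /gCB/gBA.
- by split=> x xA /=; rewrite ?hK2 ?hK1 ?gK1 ?gK2// ?inB ?inB'.
- move: hc1 hc2; rewrite !continuous_open_subspace// => hc1 hc2 x xA.
  by apply: continuous_comp; [exact: hc1|apply: hc2; exact: inB].
- move: gc1 gc2; rewrite !continuous_open_subspace// => gc1 gc2 x xA.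
  by apply: continuous_comp; [exact: gc2|apply: gc1; exact: inB'].
Qed.

Lemma increasing_homeo_translation (K : realType) (c : K) :
  increasing_homeo [set: K] [set: K] (fun y => y + c).
Proof.
split; first by move=> x y _ _; rewrite ltrD2r.
exists (fun y => y - c); split=> //.
- by split=> x _; rewrite ?addrK ?subrK.
- by apply: continuous_subspaceT => x; apply: cvgD; [exact: cvg_id|exact: cvg_cst].
- by apply: continuous_subspaceT => x; apply: cvgB; [exact: cvg_id|exact: cvg_cst].
Qed.

(** The chart is [F x - F s] to the right of the bottom [s] and [F s - F x] to
its left.  It increases strictly, so it has an inverse, and this inverse is
continuous because a monotone bijection between segments is. All small [d]
are allowed so that two valleys can be given charts onto the same interval. *)
Lemma valley_chart (K : realType) (F : K -> K) (u s v : K) :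
  valley F u s v ->
  exists2 d0 : K, 0 < d0 & forall d : K, 0 < d <= d0 ->
    exists c1 c2 : K, exists H : K -> K,
      [/\ u < c1 < s, s < c2 < v, increasing_homeo `]c1, c2[ `]- d, d[ H
        & forall x : K, c1 < x < c2 -> F x = F s + `|H x|].
Proof.
move=> [/andP[us sv] Fc Fdec Finc].
(* One formula for both branches makes continuity at [s] immediate. *)
pose H x := F (Num.max x s) - F (Num.min x s).
have Hs : H s = 0 by rewrite /H maxxx minxx subrr.
have HR x : s <= x -> H x = F x - F s by move=> sx; rewrite /H max_l// min_r.
have HL x : x <= s -> H x = F s - F x by move=> sx; rewrite /H max_r// min_l.
have Hlt x y : u < x -> x < y -> y < v -> H x < H y.
  move=> ux xy yv; have [sx|xs] := leP s x.
    by rewrite (HR x sx) (HR y (le_trans sx (ltW xy))) ltrD2r Finc.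
  have [ys|sy] := leP y s.
    by rewrite (HL x (ltW xs)) (HL y ys) ltrD2l ltrN2 Fdec.
  rewrite (HR y (ltW sy)) (HL x (ltW xs)).
  have := Fdec _ _ ux xs (lexx _); have := Finc _ _ (lexx _) sy yv; lra.
have Hcont : {in `]u, v[, continuous H}.
  move=> x; rewrite in_itv /= => /andP[ux xv]; rewrite /H.
  apply: cvgB.
    apply: (@continuous_comp _ _ _ (fun x => Num.max x s) F).
      by apply: continuous_max; [exact: cvg_id|exact: cvg_cst].
    by apply: Fc; rewrite in_itv /= lt_max ux /= gt_max xv sv.
  apply: (@continuous_comp _ _ _ (fun x => Num.min x s) F).
    by apply: continuous_min; [exact: cvg_id|exact: cvg_cst].
  by apply: Fc; rewrite in_itv /= lt_min ux us /= gt_min xv.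
pose a := (u + s) / 2; pose b := (s + v) / 2.
have ua : u < a by rewrite /a; lra.
have as_ : a < s by rewrite /a; lra.
have sb : s < b by rewrite /b; lra.
have bv : b < v by rewrite /b; lra.
have Ha : H a < 0 by rewrite -Hs; apply: Hlt; lra.
have Hb : 0 < H b by rewrite -Hs; apply: Hlt; lra.
have Hcab : {within `[a, b], continuous H}.
  apply: continuous_in_subspaceT => x; rewrite inE/= in_itv/= => /andP[ax xb].
  by apply: Hcont; rewrite in_itv/=; lra.
exists (Num.min (- H a) (H b)); first by rewrite lt_min oppr_gt0 Ha Hb.
move=> d; rewrite le_min => /and3P[d0 dHa dHb].
have ivt y : - d <= y <= d -> exists x : K, a <= x <= b /\ H x = y.
  move=> yd; have [] := @IVT K H a b y _ Hcab.
  - lra.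
  - by rewrite min_l ?max_r; lra.
  - by move=> c; rewrite in_itv/= => cab <-; exists c.
pose G y := xget s [set x : K | a <= x <= b /\ H x = y].
have Gab y : - d <= y <= d -> a <= G y <= b /\ H (G y) = y.
  by move=> /ivt[x xP]; rewrite /G; case: xgetP => [z _ //|] /(_ x).
have Hinj x y : a <= x <= b -> a <= y <= b -> H x = H y -> x = y.
  move=> xab yab Hxy; have [xy|yx|//] := ltgtP x y.
    by have := Hlt x y; rewrite Hxy ltxx => Hlt'; suff : false by []; apply: Hlt'; lra.
  by have := Hlt y x; rewrite Hxy ltxx => Hlt'; suff : false by []; apply: Hlt'; lra.
have Hle x y : a <= x <= b -> a <= y <= b -> H x < H y -> x < y.
  move=> xab yab Hxy; rewrite ltNge le_eqVlt; apply/negP => /orP[/eqP yx|yx].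
    by move: Hxy; rewrite yx ltxx.
  have : H y < H x by apply: Hlt; lra.
  by move=> /(lt_trans Hxy); rewrite ltxx.
have Glt y z : - d <= y -> y < z -> z <= d -> G y < G z.
  move=> dy yz zd; have [|ya Hy] := Gab y; first lra.
  by have [|za Hz] := Gab z; [lra|apply: Hle => //; rewrite Hy Hz].
have [|c1ab Hc1] := Gab (- d); first lra.
have [|c2ab Hc2] := Gab d; first lra.
have c1s : G (- d) < s by apply: Hle; rewrite ?Hc1 ?Hs; lra.
have sc2 : s < G d by apply: Hle; rewrite ?Hc2 ?Hs; lra.
exists (G (- d)), (G d), H; split; [lra|lra| |]; last first.
  move=> x xc; have [sx|xs] := leP s x.
    rewrite ger0_norm (HR x sx); first by rewrite addrC subrK.
    move: sx; rewrite le_eqVlt => /orP[/eqP <-|sx]; first by rewrite subrr.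
    by have := Finc s x (lexx _) sx; lra.
  rewrite ltr0_norm (HL x (ltW xs)); first lra.
  by have := Fdec x s _ xs (lexx _); lra.
have GH x : G (- d) < x < G d -> - d < H x < d /\ G (H x) = x.
  move=> xc; have h1 : - d < H x by rewrite -Hc1; apply: Hlt; lra.
  have h2 : H x < d by rewrite -[ltRHS]Hc2; apply: Hlt; lra.
  split; first by rewrite h1 h2.
  by have [|xab Hx] := Gab (H x); [lra|apply: Hinj => //; lra].
split.
  move=> x y; rewrite !inE/= !in_itv/= => xc yc xy; apply: Hlt; lra.
exists G; split.
- by move=> x; rewrite /= !in_itv/= => /GH[].
- move=> y; rewrite /= !in_itv/= => yd; apply/andP; split; apply: Glt; lra.
- split=> [x|y]; rewrite inE/= in_itv/=; first by move=> /GH[].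
  by move=> yd; have [|] := Gab y; first lra.
- apply: continuous_subspaceW Hcab => x; rewrite /= !in_itv/=; lra.
- apply: (@continuous_subspaceW _ _ _ `[- d, d]).
    by move=> x; rewrite /= !in_itv/=; lra.
  apply: segment_inc_surj_continuous.
    move=> x y; rewrite !in_itv/= => xd yd; apply/idP/idP.
      by apply: contraTT; rewrite -!ltNge => yx; apply: Glt; lra.
    rewrite le_eqVlt => /orP[/eqP -> //|xy]; apply/ltW/Glt; lra.
  move=> x; rewrite /= in_itv/= => xc.
  have Hxd : - d <= H x <= d.
    have [->|nx1] := eqVneq x (G (- d)); first by rewrite Hc1; lra.
    have [->|nx2] := eqVneq x (G d); first by rewrite Hc2; lra.
    have [|] := GH x; last lra.
    by rewrite !lt_neqAle eq_sym nx1 nx2.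
  exists (H x); first by rewrite /= in_itv/=.
  by have [//|xab Hx] := Gab (H x); apply: Hinj => //; lra.
Qed.

(** With charts [H] and [J] onto the same interval, [F] is [F s + |H|] and [G]
is [G s' + |J|]; hence the inverse of [J] after [H] matches the arguments, and
a translation matches the values. *)
Lemma valley_top_equivalent (K : realType) (F G : K -> K)
    (u s v u' s' v' : K) :
  valley F u s v -> valley G u' s' v' ->
  exists c1 c2 d1 d2 : K,
    [/\ u < c1 < s, s < c2 < v, u' < d1 < s', s' < d2 < v'
      & top_equivalent c1 c2 d1 d2 F G].
Proof.
move=> /valley_chart[d0 d0_gt0 FH] /valley_chart[d0' d0'_gt0 GH].
pose d := Num.min d0 d0'.
have d_gt0 : 0 < d by rewrite lt_min d0_gt0.
have [|c1 [c2 [H [uc1 c2v Hh FE]]]] := FH d; first by rewrite d_gt0 ge_min lexx.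
have [|d1 [d2 [J [ud1 d2v Jh GE]]]] := GH d.
  by rewrite d_gt0 ge_min lexx orbT.
have [I Ih JK] := increasing_homeo_inverse Jh.
exists c1, c2, d1, d2; split=> //.
exists (I \o H), (fun y => y + (G s' - F s)); split.
- exact: increasing_homeo_comp Hh Ih.
- exact: increasing_homeo_translation.
- move=> x xc; have HxB := increasing_homeo_in Hh (mem_set xc).
  have IHx := increasing_homeo_in Ih HxB.
  rewrite inE/= in_itv/= in IHx; rewrite in_itv/= in xc.
  by rewrite (FE x)// (GE _ IHx) /= JK//; lra.
Qed.

(** * Slopes of a weighted average of translates *)

Definition weighted_average (K : realType) (k : nat) (p t : 'I_k -> K)
    (f : K -> K) (alpha x : K) : K :=
  \sum_(i < k) p i * f (x - t i * alpha).

Lemma mean_value_off0 (K : realType) (f : K -> K) (eps x y : K) :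
  {in `]- eps, eps[, continuous f} ->
  (forall z : K, - eps < z < eps -> z != 0 -> derivable f z 1) ->
  - eps < x -> x < y -> y < eps -> (y <= 0) || (0 <= x) ->
  exists2 c : K, x < c < y & f y - f x = derive1 f c * (y - x).
Proof.
move=> f_cont f_der ex xy ye xy0.
have [| |c] := @MVT K f (derive1 f) x y xy.
- move=> z; rewrite in_itv/= => /andP[xz zy]; rewrite derive1E; apply: derivableP.
  apply: f_der; first by rewrite (lt_trans ex xz) (lt_trans zy ye).
  by case/orP: xy0 => h; [rewrite lt_eqF ?(lt_le_trans zy)|rewrite gt_eqF ?(le_lt_trans h)].
- apply: continuous_in_subspaceT => z; rewrite inE/= in_itv/= => /andP[xz zy].
  by apply: f_cont; rewrite in_itv/= (lt_le_trans ex xz) (le_lt_trans zy ye).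
- by rewrite in_itv/= => xcy ->; exists c.
Qed.

Section Slopes.
Variables (K : realType) (eps : K) (f : K -> K).
Hypothesis eps_gt0 : 0 < eps.
Hypothesis f_cont : {in `]- eps, eps[, continuous f}.
Hypothesis f_der : forall z : K, - eps < z < eps -> z != 0 -> derivable f z 1.

(** Nothing is assumed on [P], which serves below both for closeness to a
finite limit and for one-sided bounds when the limit is infinite. *)
Lemma left_slopes (P : K -> Prop) :
  (\forall x \near 0^'-, P (derive1 f x)) ->
  \forall d \near 0^'+, forall x y : K, - d < x -> x < y -> y <= 0 ->
    exists2 q : K, P q & f y - f x = q * (y - x).
Proof.
move=> [r /= r0 rP]; near=> d => x y dx xy y0.
have [||||c xcy ->] := @mean_value_off0 _ f eps x y f_cont f_der.
- by rewrite (le_lt_trans _ dx)// lerN2; near: d; exact: nbhs_right_le.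
- by [].
- exact: le_lt_trans y0 eps_gt0.
- by rewrite y0.
have dr : d <= r by near: d; exact: nbhs_right_le.
exists (derive1 f c) => //; apply: rP; last lra.
by rewrite /= sub0r normrN ltr0_norm; lra.
Unshelve. all: by end_near. Qed.

Lemma right_slopes (P : K -> Prop) :
  (\forall x \near 0^'+, P (derive1 f x)) ->
  \forall d \near 0^'+, forall x y : K, 0 <= x -> x < y -> y < d ->
    exists2 q : K, P q & f y - f x = q * (y - x).
Proof.
move=> [r /= r0 rP]; near=> d => x y x0 xy yd.
have [||||c xcy ->] := @mean_value_off0 _ f eps x y f_cont f_der.
- by rewrite (lt_le_trans _ x0)// oppr_lt0.
- by [].
- by rewrite (lt_le_trans yd)//; near: d; exact: nbhs_right_le.
- by rewrite x0 orbT.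
have dr : d <= r by near: d; exact: nbhs_right_le.
exists (derive1 f c) => //; apply: rP; last lra.
by rewrite /= sub0r normrN gtr0_norm; lra.
Unshelve. all: by end_near. Qed.

(** Applied to a neighbourhood of the limit of the derivative, this tells
which sign that limit can have. *)
Lemma decreasing_left_slope (P : K -> Prop) :
  {in `]- eps, 0] &, {homo f : x y / x < y >-> y < x}} ->
  (\forall x \near 0^'-, P (derive1 f x)) -> exists2 q : K, P q & q < 0.
Proof.
move=> f_decr /left_slopes fP; near (0 : K)^'+ => d.
have d0 : 0 < d by [].
have de : d < eps by near: d; exact: nbhs_right_lt.
have [||||q Pq qE] := near fP d _ (- (d / 2)) 0; [by []|lra|lra|by []|].
have f0 : f 0 < f (- (d / 2)) by apply: f_decr; rewrite ?in_itv/=; lra.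
exists q => //; have : q * (d / 2) < 0 by move: qE; rewrite sub0r opprK; lra.
by rewrite pmulr_llt0//; lra.
Unshelve. all: by end_near. Qed.

Lemma increasing_right_slope (Q : K -> Prop) :
  {in `[0, eps[ &, {homo f : x y / x < y}} ->
  (\forall x \near 0^'+, Q (derive1 f x)) -> exists2 q : K, Q q & 0 < q.
Proof.
move=> f_incr /right_slopes fQ; near (0 : K)^'+ => d.
have d0 : 0 < d by [].
have de : d < eps by near: d; exact: nbhs_right_lt.
have [||||q Qq qE] := near fQ d _ 0 (d / 2); [by []|by []|lra|lra|].
have f0 : f 0 < f (d / 2) by apply: f_incr; rewrite ?in_itv/=; lra.
exists q => //; have : 0 < q * (d / 2) by move: qE; rewrite subr0; lra.
by rewrite pmulr_lgt0//; lra.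
Unshelve. all: by end_near. Qed.

(** The two conditions on [x] and [y] say that no corner [t i * alpha] lies
strictly between them: the translates of index below [j] are on their left
branch over [[x, y]], the others on their right branch, and each one gets its
own slope from the mean value theorem. *)
Lemma weighted_average_slopes (k : nat) (p t : 'I_k -> K) (P Q : K -> Prop) :
  (forall i, -1 <= t i <= 1) ->
  (\forall x \near 0^'-, P (derive1 f x)) ->
  (\forall x \near 0^'+, Q (derive1 f x)) ->
  \forall e \near 0^'+, forall (j : nat) (alpha x y : K),
    0 < alpha < e -> - e < x -> x < y -> y < e ->
    (forall i : 'I_k, (i < j)%N -> y <= t i * alpha) ->
    (forall i : 'I_k, (j <= i)%N -> t i * alpha <= x) ->
    exists q : 'I_k -> K,
      [/\ forall i : 'I_k, (i < j)%N -> P (q i),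
          forall i : 'I_k, (j <= i)%N -> Q (q i)
        & weighted_average p t f alpha y - weighted_average p t f alpha x =
          (\sum_(i < k) p i * q i) * (y - x)].
Proof.
move=> t1 /left_slopes fP /right_slopes fQ; near (0 : K)^'+ => d.
have d0 : 0 < d by [].
near=> e => j alpha x y /andP[a0 ae] ex xy ye yt tx.
have ed : e < d / 2 by near: e; apply: nbhs_right_lt; lra.
have ta i : - e < t i * alpha < e.
  have /andP[t1l t1r] := t1 i; apply/andP; split; nra.
have : forall i : 'I_k, exists q, [/\ (i < j)%N -> P q, (j <= i)%N -> Q q
    & f (y - t i * alpha) - f (x - t i * alpha) = q * (y - x)].
  move=> i; have tai := ta i.
  have yxE : y - t i * alpha - (x - t i * alpha) = y - x by lra.
  have [ij|ji] := ltnP i j.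
    have yti := yt i ij.
    have [||||q Pq] := near fP d _ (x - t i * alpha) (y - t i * alpha);
      [by []|lra|lra|lra|].
    by rewrite yxE => fE; exists q.
  have tix := tx i ji.
  have [||||q Qq] := near fQ d _ (x - t i * alpha) (y - t i * alpha);
    [by []|lra|lra|lra|].
  by rewrite yxE => fE; exists q.
move=> /choice[q qP]; exists q; split.
- by move=> i ij; case: (qP i) => /(_ ij).
- by move=> i ij; case: (qP i) => _ /(_ ij).
- rewrite /weighted_average -sumrB mulr_suml; apply: eq_bigr => i _.
  by rewrite -mulrBr -mulrA; case: (qP i) => _ _ ->.
Unshelve. all: by end_near. Qed.

End Slopes.

(** * The change of sign of the slopes *)

Lemma XsumE (K : realType) (k : nat) (p : 'I_k -> K) (l r : K) (j : nat) :
  Xsum p l r j = \sum_(i < k) p i * (if (i < j)%N then l else r).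
Proof.
rewrite /Xsum !mulr_sumr [RHS](bigID (fun i : 'I_k => (i < j)%N)) /=; congr (_ + _).
  by apply: eq_bigr => i ->; rewrite mulrC.
by apply: eq_big => [i|i]; rewrite leqNgt// => /negbTE ->; rewrite mulrC.
Qed.

(** Raising [j] replaces slopes [r] by smaller slopes [l]. *)
Lemma Xsum_nonincreasing (K : realType) (k : nat) (p : 'I_k -> K) (l r : K)
    (i j : nat) :
  (forall i, 0 <= p i) -> l <= r -> (i <= j)%N ->
  Xsum p l r j <= Xsum p l r i.
Proof.
move=> p0 lr ij; rewrite !XsumE; apply: ler_sum => n _.
apply: ler_wpM2l => //; case: ltnP => nj; case: ltnP => ni //.
by have := leq_trans ni ij; rewrite ltnNge nj.
Qed.

(** [m] is the last index up to which [P] holds; the value 0, where nothing is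
required, is the case in which [P] never holds. *)
Lemma downward_closed_sign_change (k : nat) (P Q : pred nat) :
  (0 < k)%N ->
  (forall i j : nat, (1 <= i)%N -> (i <= j)%N -> P j -> P i) ->
  (forall j : nat, (1 <= j < k)%N -> ~~ P j -> Q j) ->
  exists2 m : nat, (m < k)%N & forall j : nat, (1 <= j < k)%N ->
    ((j <= m)%N -> P j) /\ ((m < j)%N -> Q j).
Proof.
move=> k0 Pdown PQ; pose T := [pred j | (j < k)%N && ((j == 0%N) || P j)].
have exT : exists j, T j by exists 0%N; rewrite /= k0.
have Tk j : T j -> (j <= k)%N by move=> /andP[/ltnW].
case: (ex_maxnP exT Tk) => m /andP[mk mP] m_max; exists m => // j /andP[j1 jk].
split=> [jm|mj].
  case/orP: mP => [/eqP m0|]; last exact: Pdown.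
  by move: j1; rewrite leqNgt ltnS (leq_trans jm)// m0.
apply: PQ; first by rewrite j1.
apply/negP => Pj; have := m_max j; rewrite /= jk Pj orbT => /(_ isT).
by rewrite leqNgt mj.
Qed.
Lemma fin_lim_near (K : realType) (F : set_system K) (FF : Filter F)
    (u : K -> K) (l d : K) :
  0 < d -> (u x)%:E @[x --> F] --> l%:E -> \forall x \near F, `|u x - l| < d.
Proof.
move=> d0 ul; have ul' : u x @[x --> F] --> l.
  exact: (@fine_cvg _ _ F FF (fun x => (u x)%:E) l ul).
by move/cvgrPdistC_lt : ul' => /(_ _ d0).
Qed.

Section SignPattern.
Variables (K : realType) (k : nat) (p : 'I_k -> K).
Hypothesis p_gt0 : forall i, 0 < p i.
Hypothesis p_sum : \sum_(i < k) p i = 1.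

Lemma weights_nonempty : (0 < k)%N.
Proof.
case: k p p_sum => [|//] p' /eqP; by rewrite big_ord0 eq_sym oner_eq0.
Qed.

(** [P] and [Q] are the slopes allowed on the left and on the right branch; the
weighted sums of such slopes are positive on the pieces of index at most [m]
and negative on the others.  A property of slopes rather than a limit covers
finite and infinite limits at once. *)
Definition slopes_sign_change (P Q : K -> Prop) (m : nat) : Prop :=
  forall (j : nat) (q : 'I_k -> K), (1 <= j < k)%N ->
    (forall i : 'I_k, (i < j)%N -> P (q i)) ->
    (forall i : 'I_k, (j <= i)%N -> Q (q i)) ->
    ((j <= m)%N -> 0 < \sum_(i < k) p i * q i) /\
    ((m < j)%N -> \sum_(i < k) p i * q i < 0).

(** As the weights sum to 1, slopes within [d] of [l] and [r] give a weighted
sum within [d] of the corresponding [Xsum]; hence [d] has to be at most the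
smallest absolute value of these nonzero numbers. *)
Lemma finite_slopes_sign_change (l r : K) :
  (forall j : nat, (1 <= j < k)%N -> Xsum p l r j != 0) -> l <= r ->
  exists2 m : nat, (m < k)%N & exists2 d : K, 0 < d &
    slopes_sign_change (fun q => `|q - l| < d) (fun q => `|q - r| < d) m.
Proof.
move=> X_neq0 lr.
have Xneg j : (1 <= j < k)%N -> ~~ (0 < Xsum p l r j) -> Xsum p l r j < 0.
  by move=> jk; rewrite -leNgt lt_neqAle X_neq0.
have [m mk mP] := @downward_closed_sign_change k
  (fun j => 0 < Xsum p l r j) (fun j => Xsum p l r j < 0) weights_nonempty
  (fun i j _ ij Xj => lt_le_trans Xj
    (Xsum_nonincreasing (fun i => ltW (p_gt0 i)) lr ij))
  Xneg.
exists m => //.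
have [d d0 dX] : exists2 d : K, 0 < d & forall j : 'I_k, (1 <= j < k)%N ->
    d <= `|Xsum p l r j|.
  have dX : \forall d \near (0 : K)^'+, forall j : 'I_k, (1 <= j < k)%N ->
      d <= `|Xsum p l r j|.
    apply: filter_forall => j; have [jk|jk] := boolP (1 <= j < k)%N.
      by near=> d => _; near: d; apply: nbhs_right_le; rewrite normr_gt0 X_neq0.
    by near=> d.
  near (0 : K)^'+ => d; exists d => //; exact: (near dX d).
exists d => // j q jk Pq Qq.
have [j1 jk'] := andP jk; have {}dX := dX (Ordinal jk') jk.
have close : `|\sum_(i < k) p i * q i - Xsum p l r j| < d.
  rewrite XsumE -sumrB (le_lt_trans (ler_norm_sum _ _ _))//.
  rewrite -[ltRHS]mul1r -p_sum mulr_suml; apply: ltr_sum => [|i _].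
    by apply/hasP; exists (Ordinal jk'); rewrite ?mem_index_enum.
  rewrite -mulrBr normrM gtr0_norm// ltr_pM2l//.
  by case: ltnP => ij; [exact: Pq|exact: Qq].
have [Xpos {}Xneg] := mP j jk; split=> [/Xpos|/Xneg] X0.
  by move: dX close; rewrite /= gtr0_norm// ltr_norml; lra.
by move: dX close; rewrite /= ltr0_norm// ltr_norml; lra.
Unshelve. all: by end_near. Qed.

(** On every piece the translate of the last index is on its right branch, so
its steep slope makes the sum positive as soon as its weighted contribution
exceeds [`|l| + 1], a bound for what the other terms can subtract. *)
Lemma steep_right_slopes_sign_change (l : K) :
  exists M : K, slopes_sign_change (fun q => `|q - l| < 1) (fun q => M < q) k.-1.
Proof.
have k0 := weights_nonempty; have kk : (k.-1 < k)%N by rewrite prednK.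
pose i0 := Ordinal kk.
exists ((`|l| + 1) / p i0) => j q /andP[j1 jk] Pq Qq.
split=> [_|]; last by rewrite ltnNge -ltnS prednK// jk.
have p0 := p_gt0 i0; have l0 := normr_ge0 l.
have qi i : - (`|l| + 1) <= q i.
  have [ij|ji] := ltnP i j.
    have nl : - l <= `|l| by rewrite -normrN ler_norm.
    by have := Pq i ij; rewrite /= ltr_norml => /andP[ql _]; lra.
  have : 0 <= (`|l| + 1) / p i0 by rewrite divr_ge0//; lra.
  by have := Qq i ji; rewrite /=; lra.
rewrite (bigD1 i0)//=.
have h1 : `|l| + 1 < p i0 * q i0.
  by rewrite mulrC -ltr_pdivrMr//; apply: Qq; rewrite /= -ltnS prednK.
have h2 : - (`|l| + 1) <= \sum_(i < k | i != i0) p i * q i.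
  have h3 : \sum_(i < k | i != i0) p i * - (`|l| + 1) <= \sum_(i < k | i != i0) p i * q i.
    by apply: ler_sum => i _; rewrite ler_pM2l.
  apply: le_trans h3; rewrite -mulr_suml.
  have : \sum_(i < k | i != i0) p i <= 1 by rewrite -p_sum [leRHS](bigD1 i0)//= lerDr ltW.
  nra.
lra.
Qed.

(** The mirror image: the translate of index 0 is on its left branch on every
piece. *)
Lemma steep_left_slopes_sign_change (r : K) :
  exists M : K, slopes_sign_change (fun q => q < M) (fun q => `|q - r| < 1) 0.
Proof.
have k0 := weights_nonempty; pose i0 := Ordinal k0.
exists (- ((`|r| + 1) / p i0)) => j q /andP[j1 jk] Pq Qq.
split=> [|_]; first by rewrite leqNgt j1.
have p0 := p_gt0 i0; have r0 := normr_ge0 r.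
have qi i : q i <= `|r| + 1.
  have [ij|ji] := ltnP i j; last first.
    have nr : r <= `|r| by exact: ler_norm.
    by have := Qq i ji; rewrite /= ltr_norml => /andP[_ qr]; lra.
  have : 0 <= (`|r| + 1) / p i0 by rewrite divr_ge0//; lra.
  by have := Pq i ij; rewrite /=; lra.
rewrite (bigD1 i0)//=.
have h1 : p i0 * q i0 < - (`|r| + 1).
  by rewrite mulrC -ltr_pdivlMr// mulNr; apply: Pq.
have h2 : \sum_(i < k | i != i0) p i * q i <= `|r| + 1.
  have h3 : \sum_(i < k | i != i0) p i * q i <= \sum_(i < k | i != i0) p i * (`|r| + 1).
    by apply: ler_sum => i _; rewrite ler_pM2l.
  apply: (le_trans h3); rewrite -mulr_suml.
  have : \sum_(i < k | i != i0) p i <= 1 by rewrite -p_sum [leRHS](bigD1 i0)//= lerDr ltW.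
  nra.
lra.
Qed.

End SignPattern.

(** * The averaging near the minimum *)

Section Valley.
Variables (K : realType) (eps : K) (f : K -> K).
Hypothesis eps_gt0 : 0 < eps.
Hypothesis f_cont : {in `]- eps, eps[, continuous f}.
Hypothesis f_der : forall z : K, - eps < z < eps -> z != 0 -> derivable f z 1.
Hypothesis f_decr : {in `]- eps, 0] &, {homo f : x y / x < y >-> y < x}}.
Hypothesis f_incr : {in `[0, eps[ &, {homo f : x y / x < y}}.

(** By monotonicity of [f], a finite [L] is at most 0, a finite [R] at least 0,
and an infinite limit can only be minus infinity on the left and plus infinity
on the right; then one of the sign change lemmas above applies. *)
Lemma slopes_sign_change_exists (k : nat) (p : 'I_k -> K) (L R : \bar K) :
  (forall i, 0 < p i) -> \sum_(i < k) p i = 1 ->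
  (derive1 f x)%:E @[x --> 0^'-] --> L ->
  (derive1 f x)%:E @[x --> 0^'+] --> R ->
  [/\ L \is a fin_num, R \is a fin_num
     & forall j : nat, (1 <= j < k)%N -> Xsum p (fine L) (fine R) j != 0] \/
  (L \isn't a fin_num /\ R \is a fin_num) \/
  (L \is a fin_num /\ R \isn't a fin_num) ->
  exists P Q : K -> Prop, exists2 m : 'I_k,
    (\forall x \near 0^'-, P (derive1 f x)) /\
    (\forall x \near 0^'+, Q (derive1 f x)) &
    slopes_sign_change p P Q m.
Proof.
move=> p_gt0 p_sum f_L f_R; have k0 := weights_nonempty p_sum.
have left_neg P := @decreasing_left_slope _ _ _ eps_gt0 f_cont f_der P f_decr.
have right_pos Q := @increasing_right_slope _ _ _ eps_gt0 f_cont f_der Q f_incr.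
have kk : (k.-1 < k)%N by rewrite prednK.
case=> [[Lfin Rfin X_neq0]|[[Linf Rfin]|[Lfin Rinf]]].
- move: f_L f_R X_neq0; rewrite -(fineK Lfin) -(fineK Rfin).
  move: (fine L) (fine R) => l r f_l f_r X_neq0.
  have l0 : l <= 0.
    rewrite leNgt; apply/negP => l0.
    have [q /=] := left_neg (fun q => `|q - l| < l) (fin_lim_near _ l0 f_l).
    by rewrite ltr_norml; lra.
  have r0 : 0 <= r.
    rewrite leNgt; apply/negP => r0; have r0' : 0 < - r by lra.
    have [q /=] := right_pos (fun q => `|q - r| < - r) (fin_lim_near _ r0' f_r).
    by rewrite ltr_norml; lra.
  have [|m mk [d d0 dm]] :=
    finite_slopes_sign_change p_gt0 p_sum X_neq0; first exact: le_trans r0.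
  exists (fun q => `|q - l| < d), (fun q => `|q - r| < d), (Ordinal mk) => //.
  by split; exact: fin_lim_near.
- have LNy : L = -oo%E.
    case: L Linf f_L => [//| |//] _ f_L.
    have f_gt0 : \forall x \near 0^'-, 0 < derive1 f x by exact: cvgey_gt f_L 0.
    by have [q q0 /(lt_trans q0)] := left_neg (fun q => 0 < q) f_gt0; rewrite ltxx.
  rewrite LNy in f_L; move: f_R; rewrite -(fineK Rfin) => f_R.
  have [M hM] := steep_left_slopes_sign_change p_gt0 p_sum (fine R).
  exists (fun q => q < M), (fun q => `|q - fine R| < 1), (Ordinal k0) => //.
  by split; [exact: cvgeNy_lt f_L M|exact: fin_lim_near].
- have RNy : R = +oo%E.
    case: R Rinf f_R => [//|//|] _ f_R.
    have f_lt0 : \forall x \near 0^'+, derive1 f x < 0 by exact: cvgeNy_lt f_R 0.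
    by have [q q0 /lt_trans/(_ q0)] := right_pos (fun q => q < 0) f_lt0; rewrite ltxx.
  rewrite RNy in f_R; move: f_L; rewrite -(fineK Lfin) => f_L.
  have [M hM] := steep_right_slopes_sign_change p_gt0 p_sum (fine L).
  exists (fun q => `|q - fine L| < 1), (fun q => M < q), (Ordinal kk) => //.
  by split; [exact: fin_lim_near|exact: cvgey_gt f_R M].
Qed.

Lemma weighted_average_continuous (k : nat) (p t : 'I_k -> K) (alpha x : K) :
  (forall i, - eps < x - t i * alpha < eps) ->
  {for x, continuous (weighted_average p t f alpha)}.
Proof.
move=> xt; rewrite /weighted_average.
apply: (@cvg_big _ _ _ _ _ _ _ _ _ (fun i x => p i * f (x - t i * alpha))).
  exact: add_continuous.
move=> i _; apply: cvgM; first exact: cvg_cst.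
suff : {for x, continuous (f \o (fun y => y - t i * alpha))} by [].
apply: continuous_comp; first by apply: cvgB; [exact: cvg_id|exact: cvg_cst].
by apply: f_cont; rewrite in_itv/=; exact: xt.
Qed.

(** The bottom is the corner of index [m], where the slopes change sign.  The
signs on the separate pieces are glued at the corners by induction, starting
from the two unbounded pieces, where all the translates vary in the same
direction. *)
Lemma weighted_average_valley (k : nat) (p t : 'I_k -> K) (P Q : K -> Prop)
    (m : 'I_k) :
  (forall i, 0 < p i) -> \sum_(i < k) p i = 1 -> (forall i, -1 <= t i <= 1) ->
  (forall i j : 'I_k, (i < j)%N -> t j < t i) ->
  (\forall x \near 0^'-, P (derive1 f x)) ->
  (\forall x \near 0^'+, Q (derive1 f x)) ->
  slopes_sign_change p P Q m ->
  \forall e \near 0^'+, forall alpha : K, 0 < alpha < e ->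
    valley (weighted_average p t f alpha) (- e) (t m * alpha) e.
Proof.
move=> p_gt0 p_sum t1 t_decr f_P f_Q mPQ.
have slopes := weighted_average_slopes eps_gt0 f_cont f_der p t1 f_P f_Q.
near=> e => alpha alphae; have /andP[a0 ae] := alphae.
have ee : e < eps / 2 by near: e; apply: nbhs_right_lt; rewrite divr_gt0.
have t_le (i j : 'I_k) : (i <= j)%N -> t j * alpha <= t i * alpha.
  rewrite leq_eqVlt => /orP[/eqP/val_inj ->//|/t_decr ji].
  by rewrite ler_pM2r// ltW.
have ta i : - e < t i * alpha < e.
  have := t1 i => /andP[t1l t1r].
  have h1 : 0 <= (t i + 1) * alpha by apply: mulr_ge0; lra.
  have h2 : 0 <= (1 - t i) * alpha by apply: mulr_ge0; lra.
  by move: h1 h2; rewrite mulrDl mulrBl mul1r; lra.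
have k0 := weights_nonempty p_sum.
have pieces (j : nat) (x y : K) : (1 <= j < k)%N -> - e < x -> x < y -> y < e ->
    (forall i : 'I_k, (i < j)%N -> y <= t i * alpha) ->
    (forall i : 'I_k, (j <= i)%N -> t i * alpha <= x) ->
    ((j <= m)%N -> weighted_average p t f alpha x < weighted_average p t f alpha y) /\
    ((m < j)%N -> weighted_average p t f alpha y < weighted_average p t f alpha x).
  move=> jk ex xy ye yt tx.
  have [|q [Pq Qq qE]] := near slopes e _ j alpha x y alphae ex xy ye yt tx; first by [].
  have [pos neg] := mPQ j q jk Pq Qq; have xy0 : 0 < y - x by rewrite subr_gt0.
  split=> [/pos|/neg] q0; rewrite -subr_gt0; first by rewrite qE mulr_gt0.
  by rewrite -opprB qE oppr_gt0 pmulr_llt0.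
have sum_lt (F G : 'I_k -> K) : (forall i, F i < G i) ->
    \sum_(i < k) p i * F i < \sum_(i < k) p i * G i.
  move=> FG; apply: ltr_sum => [|i _]; last by rewrite ltr_pM2l.
  by apply/hasP; exists (Ordinal k0); rewrite ?mem_index_enum.
(* The corners go left as [j] increases, so each step of the induction adds one
   piece on the left of the half-line where the averaging is known to increase. *)
have incr (j : nat) (jk : (j < k)%N) : (j <= m)%N -> forall x y : K,
    t (Ordinal jk) * alpha <= x -> x < y -> y < e ->
    weighted_average p t f alpha x < weighted_average p t f alpha y.
  elim: j jk => [|j IH] jk jm x y tx xy ye.
    apply: sum_lt => i; have tai := ta i.
    have tix : t i * alpha <= x by apply: le_trans tx; exact: t_le.
    by apply: f_incr; rewrite ?in_itv/=; lra.
  have jk' := ltnW jk; have {}IH := IH jk' (ltnW jm).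
  have ext := ta (Ordinal jk).
  have left_piece z : z <= t (Ordinal jk') * alpha -> x < z -> z < e ->
      weighted_average p t f alpha x < weighted_average p t f alpha z.
    move=> zt xz ze; have [||||i ij|i ji|->//] := pieces j.+1 x z.
    - by rewrite jk.
    - by apply: lt_le_trans tx; case/andP: ext.
    - by [].
    - by [].
    - by apply: le_trans zt _; exact: t_le.
    - by apply: le_trans tx; exact: t_le.
  have [tjx|xtj] := leP (t (Ordinal jk') * alpha) x; first exact: IH.
  have [ytj|tjy] := leP y (t (Ordinal jk') * alpha); first exact: left_piece.
  apply: lt_trans (left_piece (t (Ordinal jk') * alpha) _ _ _) (IH _ _ _ _ _) => //.
  exact: lt_trans ye.
(* Here pieces are added on the right as [j] goes down; [d] is the number of
   corners to the left of corner [j]. *)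
have decr (d j : nat) (jk : (j < k)%N) : (m <= j)%N -> (d + j)%N = k.-1 ->
    forall x y : K, - e < x -> x < y -> y <= t (Ordinal jk) * alpha ->
    weighted_average p t f alpha y < weighted_average p t f alpha x.
  elim: d j jk => [|d IH] j jk mj djk x y ex xy yt.
    apply: sum_lt => i; have tai := ta i.
    have yti : y <= t i * alpha.
      by apply: le_trans yt _; apply: t_le; rewrite /= -ltnS -[j]add0n djk prednK.
    by apply: f_decr; rewrite ?in_itv/=; lra.
  have jk' : (j.+1 < k)%N.
    by rewrite -(prednK k0) ltnS -djk addSn ltnS leq_addl.
  have {}IH := IH j.+1 jk' (leqW mj) (etrans (addnS _ _) djk).
  have ext := ta (Ordinal jk).
  have right_piece z : t (Ordinal jk') * alpha <= z -> - e < z -> z < y ->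
      weighted_average p t f alpha y < weighted_average p t f alpha z.
    move=> tz ez zy; have [||||i ij|i ji|_ ->//] := pieces j.+1 z y.
    - by rewrite jk'.
    - by [].
    - by [].
    - by apply: le_lt_trans yt _; case/andP: ext.
    - by apply: le_trans yt _; exact: t_le.
    - by apply: le_trans tz; exact: t_le.
  have [ytj|tjy] := leP y (t (Ordinal jk') * alpha); first exact: IH.
  have [tjx|xtj] := leP (t (Ordinal jk') * alpha) x; first exact: right_piece.
  apply: lt_trans (right_piece (t (Ordinal jk') * alpha) _ _ _) (IH _ _ _ _ _) => //.
  exact: lt_trans ex _.
have mE : Ordinal (ltn_ord m) = m by exact: val_inj.
split.
- exact: ta.
- move=> x; rewrite in_itv/= => xe; apply: weighted_average_continuous => i.
  by have tai := ta i; lra.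
- move=> x y ex xy yt; apply: (decr (k.-1 - m)%N m (ltn_ord m)) => //.
  + by rewrite subnK// -ltnS prednK.
  + by rewrite mE.
- move=> x y tx xy ye; apply: (incr m (ltn_ord m)) => //.
  by rewrite mE.
Unshelve. all: by end_near. Qed.

End Valley.

Lemma eq_top_equivalent (K : realType) (a b c d : K) (F F' G G' : K -> K) :
  {in `]a, b[, F =1 F'} -> {in `]c, d[, G =1 G'} ->
  top_equivalent a b c d F G -> top_equivalent a b c d F' G'.
Proof.
move=> FF' GG' [h [phi [hh hphi FG]]]; exists h, phi; split=> // x xab.
rewrite -FF'// FG// GG'//.
have := increasing_homeo_in hh (mem_set xab).
by rewrite inE.
Qed.

Theorem theorem5p1 (K : realType)
  (mu : probability (measurableTypeR K) K)
  (mu_interval : mu `[-1, 1]%classic = 1%E)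
  (k : nat) (t : 'I_k -> K)
  (t_decr : forall i j : 'I_k, (i < j)%N -> t j < t i)
  (mu_support : measure_support mu = range t)
  (p : 'I_k -> K)
  (p_def : forall i : 'I_k, mu [set t i] = (p i)%:E)
  (eps : K) (eps_gt0 : 0 < eps)
  (f : K -> K)
  (f_cont : {in `]- eps, eps[, continuous f})
  (f_min : isolated_local_min f 0)
  (f_decr : {in `]- eps, 0] &, {homo f : x y / x < y >-> y < x}})
  (f_incr : {in `[0, eps[ &, {homo f : x y / x < y}})
  (f_C1 : forall x : K, - eps < x < eps -> x != 0 ->
     derivable f x 1 /\ {for x, continuous (derive1 f)})
  (L R : \bar K)
  (f_L : (derive1 f x)%:E @[x --> 0^'-] --> L)
  (f_R : (derive1 f x)%:E @[x --> 0^'+] --> R)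
  (hab :
     [/\ L \is a fin_num, R \is a fin_num
       & forall j : nat, (1 <= j < k)%N -> Xsum p (fine L) (fine R) j != 0]
     \/ (L \isn't a fin_num /\ R \is a fin_num)
     \/ (L \is a fin_num /\ R \isn't a fin_num)) :
  germ_stable mu 0 f.
Proof.
move=> u v g /andP[u0 v0] g_cont gf.
have t_inj : injective t.
  move=> i j tij; apply/val_inj; have [/t_decr|/t_decr|//] := ltngtP i j.
    by rewrite tij ltxx.
  by rewrite tij ltxx.
have t1 i : -1 <= t i <= 1.
  have ti : measure_support mu (t i) by rewrite mu_support; exists i.
  have cI : closed (`[-1, 1]%classic : set K) by exact: interval_closed.
  by have := measure_support_closed cI mu_interval ti; rewrite /= in_itv.
have p_gt0 i : 0 < p i by exact: finite_support_weight_gt0 t_inj mu_support p_def.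
have p_sum := finite_support_weight_sum t_inj mu_support p_def.
have f_der (z : K) : - eps < z < eps -> z != 0 -> derivable f z 1.
  by move=> ze z0; have [] := f_C1 z ze z0.
have [P [Q [m [f_P f_Q] mPQ]]] := slopes_sign_change_exists eps_gt0 f_cont f_der
  f_decr f_incr p_gt0 p_sum f_L f_R hab.
have valleys := weighted_average_valley eps_gt0 f_cont f_der f_decr f_incr
  p_gt0 p_sum t1 t_decr f_P f_Q mPQ.
move: gf => [r /= r0 gf].
near (0 : K)^'+ => e.
have e0 : 0 < e by [].
have eeps : e < eps by near: e; exact: nbhs_right_lt.
(* Halves, because [x - s * alpha] ranges over (-2e, 2e). *)
have er : e < r / 2 by near: e; apply: nbhs_right_lt; rewrite divr_gt0.
have eu : e < - u / 2 by near: e; apply: nbhs_right_lt; rewrite divr_gt0// oppr_gt0.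
have ev : e < v / 2 by near: e; apply: nbhs_right_lt; rewrite divr_gt0.
have gfE x : - (2 * e) < x < 2 * e -> g x = f x.
  by move=> xe; apply: gf; rewrite /= sub0r normrN ltr_norml; lra.
have f_valley : valley f (- e) 0 e.
  split.
  - by rewrite oppr_lt0 e0.
  - by move=> x; rewrite in_itv/= => xe; apply: f_cont; rewrite in_itv/=; lra.
  - by move=> x y ex xy y0; apply: f_decr; rewrite ?in_itv/=; lra.
  - by move=> x y x0 xy ye; apply: f_incr; rewrite ?in_itv/=; lra.
exists e; split=> //; first lra.
move=> alpha alphae; have /andP[a0 ae] := alphae; split; first lra.
have [|c1 [c2 [d1 [d2 [c1b c2b d1b d2b fS]]]]] :=
  valley_top_equivalent f_valley (near valleys e _ alpha alphae); first by [].
exists c1, c2, d1, d2; rewrite sub0r add0r; split; last first.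
- apply: eq_top_equivalent fS => x; rewrite in_itv/= => xcd.
    by rewrite gfE//; lra.
  have shift (s : K) : -1 <= s <= 1 -> - (2 * e) < x - s * alpha < 2 * e.
    move=> /andP[s1 s2].
    have h1 : 0 <= (s + 1) * alpha by apply: mulr_ge0; lra.
    have h2 : 0 <= (1 - s) * alpha by apply: mulr_ge0; lra.
    by move: h1 h2; rewrite mulrDl mulrBl mul1r; lra.
  rewrite (averaging_finite_support t_inj mu_support p_def t1 g_cont).
    by apply: eq_bigr => i _; rewrite gfE//; exact: shift.
  by move=> s /shift; lra.
- lra.
- lra.
- by rewrite !in_itv/=; split; lra.
Unshelve. all: by end_near. Qed.
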